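(* Let $b\ge 2$, $n\ge 1$, $k\ge 0$ be integers. Let $X_b^n[k]$ be the set of $n$-tuples $(x_1,\ldots,x_n)\in\{0,1,\ldots,b-1\}^n$ with $x_1+\cdots+x_n=k$, and consider the permutations $\rho,\tau$ of $X_b^n[k]$ defined by $$\rho\cdot(x_1,x_2,\ldots,x_n)=(x_2,\ldots,x_n,x_1),\qquad \tau\cdot(x_1,x_2,\ldots,x_n)=(x_2,\ldots,x_{n-1},x_1,x_n).$$ (a) If $\gcd(b,n)=1$ then the triple $\left(X_b^n[k],\genfrac{[}{]}{0pt}{}{n}{k}_q^{(b)},\langle\rho\rangle\right)$ exhibits the cyclic sieving phenomenon. More precisely, if $\omega$ is a primitive $d$th root of unity with $d\mid n$ and $\gcd(b,d)=1$, then $$\genfrac{[}{]}{0pt}{}{n}{k}_\omega^{(b)}=\#\{\mathbf{x}\in X_b^n[k]:\rho^{n/d}\cdot\mathbf{x}=\mathbf{x}\}.$$ (b) If $\gcd(b,n-1)=1$ then the triple $\left(X_b^n[k],\genfrac{[}{]}{0pt}{}{n}{k}_q^{(b)},\langle\tau\rangle\right)$ exhibits the cyclic sieving phenomenon. More precisely, if $\omega$ is a primitive $d$th root of unity with $d\mid(n-1)$ and $\gcd(b,d)=1$, then $$\genfrac{[}{]}{0pt}{}{n}{k}_\omega^{(b)}=\#\{\mathbf{x}\in X_b^n[k]:\tau^{(n-1)/d}\cdot\mathbf{x}=\mathbf{x}\}.$$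
   Context: The polynomials $\genfrac{[}{]}{0pt}{}{n}{k}_q^{(b)}\in\mathbb{N}[q]$ are defined by $$\sum_{k=0}^{(b-1)n}\genfrac{[}{]}{0pt}{}{n}{k}_q^{(b)}t^k=\prod_{i=0}^{n-1}\left(1+q^it+(q^it)^2+\cdots+(q^it)^{b-1}\right)$$ (and are $0$ for $k$ outside this range); $\genfrac{[}{]}{0pt}{}{n}{k}_\omega^{(b)}$ is the evaluation at $q=\omega\in\mathbb{C}$. The permutation $\rho$ cyclically rotates all $n$ coordinates; $\tau$ cyclically rotates the first $n-1$ coordinates and fixes the $n$th coordinate (so it is the identity when $n\le 2$). Cyclic sieving phenomenon: if a cyclic group $\langle\sigma\rangle$ of order $N$ acts on a finite set $X$ and $f(q)\in\mathbb{N}[q]$, then $(X,f(q),\langle\sigma\rangle)$ exhibits the cyclic sieving phenomenon if for every $d\mid N$ and every primitive $d$th root of unity $\omega$ one has $f(\omega)=\#\{x\in X:\sigma^{N/d}\cdot x=x\}$. Here $\langle\rho\rangle$ is regarded as the cyclic group of order $N=n$ and $\langle\tau\rangle$ as the cyclic group of order $N=n-1$, acting on $X_b^n[k]$. *)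

(* Defs.v *)
From HB Require Import structures.
From mathcomp Require Import all_boot all_order all_fingroup all_algebra.
From mathcomp Require Import complex.
From mathcomp Require Import reals.

Set Implicit Arguments.
Unset Strict Implicit.
Unset Printing Implicit Defensive.

Import GRing.Theory.

Local Open Scope ring_scope.

(* The outer indeterminate is t, the inner one is q; coefficients outside
   0 <= k <= (b - 1) n are 0 by the convention on polynomials. *)
Definition qbinom (b n k : nat) : {poly nat} :=
  let q : {poly nat} := 'X in
  let t : {poly {poly nat}} := 'X in
  (\prod_(i < n) \sum_(j < b) ((q ^+ i)%:P * t) ^+ j)`_k.

Definition evalN (K : nzRingType) (f : {poly nat}) (w : K) : K :=
  (map_poly (fun m : nat => m%:R) f).[w].

Definition Xset (b n k : nat) : finType :=
  {x : n.-tuple 'I_b | (\sum_(i < n) (tnth x i : nat) == k)%N}.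

(* The identity on sequences of size at most 2. *)
Definition rot_init (T : Type) (s : seq T) : seq T :=
  rot 1 (take (size s).-1 s) ++ drop (size s).-1 s.

Lemma size_rot_init (T : Type) (s : seq T) : size (rot_init s) = size s.
Proof. by rewrite size_cat size_rot -size_cat cat_take_drop. Qed.

Lemma perm_rot_init (T : eqType) (s : seq T) : perm_eq (rot_init s) s.
Proof.
by rewrite -[X in perm_eq _ X](cat_take_drop (size s).-1) perm_cat2r perm_rot.
Qed.

Lemma rot_init_inj (T : Type) : injective (@rot_init T).
Proof.
move=> s t e; have es : size s = size t by rewrite -size_rot_init e size_rot_init.
have e2 : size (rot 1 (take (size s).-1 s)) = size (rot 1 (take (size t).-1 t)).
  by rewrite !size_rot !size_take es.
have h1 := congr1 (take (size (rot 1 (take (size s).-1 s)))) e.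
have h2 := congr1 (drop (size (rot 1 (take (size s).-1 s)))) e.
rewrite /rot_init take_size_cat // take_size_cat // in h1.
rewrite /rot_init drop_size_cat // drop_size_cat // in h2.
by rewrite -(cat_take_drop (size s).-1 s) (rot_inj h1) h2 cat_take_drop.
Qed.

Lemma rot_init_tupleP (T : Type) (n : nat) (x : n.-tuple T) :
  size (rot_init x) == n.
Proof. by rewrite size_rot_init size_tuple. Qed.

Definition rot_init_tuple (T : Type) (n : nat) (x : n.-tuple T) : n.-tuple T :=
  Tuple (rot_init_tupleP x).

Lemma sum_tnth_perm (b n : nat) (x y : n.-tuple 'I_b) : perm_eq x y ->
  (\sum_(i < n) (tnth x i : nat) = \sum_(i < n) (tnth y i : nat))%N.
Proof.
by move=> xy; rewrite -!(big_tuple _ _ _ xpredT (fun a : 'I_b => a : nat));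
  apply: perm_big.
Qed.

Lemma rho_subproof (b n k : nat) (x : Xset b n k) :
  (\sum_(i < n) (tnth [tuple of rot 1 (val x)] i : nat) == k)%N.
Proof. by rewrite (sum_tnth_perm (y := val x)) ?perm_rot //; exact: valP x. Qed.

Lemma tau_subproof (b n k : nat) (x : Xset b n k) :
  (\sum_(i < n) (tnth (rot_init_tuple (val x)) i : nat) == k)%N.
Proof.
by rewrite (sum_tnth_perm (y := val x)) ?perm_rot_init //; exact: valP x.
Qed.

Definition rho_fun (b n k : nat) (x : Xset b n k) : Xset b n k :=
  Sub [tuple of rot 1 (val x)] (rho_subproof x).

Definition tau_fun (b n k : nat) (x : Xset b n k) : Xset b n k :=
  Sub (rot_init_tuple (val x)) (tau_subproof x).

Lemma rho_fun_inj (b n k : nat) : injective (@rho_fun b n k).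
Proof.
by move=> x y /(congr1 (fun z => val (val z))) /= /rot_inj /val_inj /val_inj.
Qed.

Lemma tau_fun_inj (b n k : nat) : injective (@tau_fun b n k).
Proof.
by move=> x y /(congr1 (fun z => val (val z))) /= /rot_init_inj /val_inj /val_inj.
Qed.

Definition rho (b n k : nat) : {perm Xset b n k} := perm (@rho_fun_inj b n k).

Definition tau (b n k : nat) : {perm Xset b n k} := perm (@tau_fun_inj b n k).

(* An action on X of a cyclic group of order N with chosen generator is a
   permutation s of X with s ^+ N = 1; it need not be faithful, so N may be a
   proper multiple of the order of s (e.g. for rho when k = 0 and n > 1). *)
Definition cyclic_sieving (R : realType) (X : finType) (f : {poly nat})
    (N : nat) (s : {perm X}) : Prop :=
  [/\ (0 < N)%N,
      (s ^+ N = 1)%g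
    & forall (d : nat) (w : R[i]), (d %| N)%N -> d.-primitive_root w ->
        evalN f w = #|[set x : X | (s ^+ (N %/ d))%g x == x]|%:R].

(* Main.v *)
(* Multiplying 1 + y + ... + y^(b-1) = (y^b - 1) / (y - 1) over y = w^i t,
   0 <= i < d, with w a primitive d-th root of unity and b prime to d, gives
   1 + t^d + ... + t^(d(b-1)).  Hence, when d e <= n <= d e + 1, the generating
   polynomial at q = w is the e-th power of that, times 1 + t + ... + t^(b-1)
   if n = d e + 1.  A tuple whose first d e entries are fixed by rotation by e
   is d copies of a word of length e followed by at most one free entry, and
   has the same generating polynomial. *)
Require Import Defs.
From mathcomp Require Import all_boot all_order all_fingroup all_algebra.
From mathcomp Require Import complex.
From mathcomp Require Import reals.

Set Implicit Arguments.
Unset Strict Implicit.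
Unset Printing Implicit Defensive.

Import GRing.Theory.

Local Open Scope ring_scope.

(** * Words fixed by a rotation *)

Lemma rot_flatten_nseq (T : Type) (d : nat) (u : seq T) :
  rot (size u) (flatten (nseq d u)) = flatten (nseq d u).
Proof.
case: d => [|d]; first by rewrite rot_oversize.
rewrite /= rot_size_cat.
elim: d => [|d IHd] /=; first by rewrite cats0.
by rewrite -catA IHd.
Qed.

(** Split off the first [e] letters, [s = u ++ v]. Invariance reads [v ++ u = u ++ v], so a nonempty
    [v] starts with [u] and is itself invariant; induct on [d]. *)
Lemma rot_fixed_flatten (T : Type) (d e : nat) (s : seq T) :
  size s = (d * e)%N -> rot e s = s -> s = flatten (nseq d (take e s)).
Proof.
elim: d s => [|d IHd] s szs fixs; first by apply: size0nil; rewrite szs.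
have szu : size (take e s) = e by rewrite size_takel // szs leq_addr.
set u := take e s in szu *; set v := drop e s.
have s_uv : s = u ++ v by rewrite cat_take_drop.
have szv : size v = (d * e)%N by rewrite size_drop szs mulSn addKn.
have vu : v ++ u = u ++ v by rewrite -s_uv; exact: fixs.
rewrite [LHS]s_uv /=; congr cat.
case: d => [|d] in IHd szs szv *; first by apply: size0nil; rewrite szv.
have uv : take e v = u.
  have := congr1 (take e) vu.
  by rewrite takel_cat ?szv ?leq_addr // -{2}szu take_size_cat.
rewrite -[in RHS]uv; apply: IHd => //.
(* Cancelling the leading [u] in [v ++ u = u ++ v], where [v = u ++ drop e v], gives
   [rot e v = v]. *)
rewrite /rot uv -[RHS](cat_take_drop e) uv.
have := vu; rewrite -[in LHS](cat_take_drop e v) -[in RHS](cat_take_drop e v).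
by rewrite uv -catA => /(congr1 (drop (size u))); rewrite !drop_size_cat.
Qed.

(** Common form of the two permutations: [m = n] gives [rho], [m = n - 1] gives [tau]. *)
Definition rot_take (T : Type) (m : nat) (s : seq T) : seq T :=
  rot 1 (take m s) ++ drop m s.

(** The bound [j <= m] matters, as [rot] is the identity beyond the length of the word. *)
Lemma iter_rot_take (T : Type) (m j : nat) (s : seq T) :
  (j <= m <= size s)%N ->
  iter j (rot_take m) s = rot j (take m s) ++ drop m s.
Proof.
elim: j => [|j IHj] /andP[jm ms]; first by rewrite rot0 cat_take_drop.
have szr : size (rot j (take m s)) = m by rewrite size_rot size_takel.
rewrite iterS IHj ?(ltnW jm) // /rot_take.
rewrite take_size_cat // drop_size_cat // -rotD ?add1n //.
by rewrite size_takel.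
Qed.

(** * Products over the powers of a primitive root of unity *)

(** Each factor is z^i (X - z^(-i)), and z^(-1) = z^(d-1) is again primitive, so the product is a
    constant times X^d - 1; the value at 0 fixes the constant. Its sign form depends only on [d],
    hence is the same for [z] and [z ^+ b]. *)
Lemma prod_prim_root (F : fieldType) (d : nat) (z : F) :
  d.-primitive_root z ->
  \prod_(i < d) ((z ^+ i)%:P * 'X - 1) = (-1) ^+ d * (1 - 'X^d) :> {poly F}.
Proof.
move=> pz; have d_gt0 := prim_order_gt0 pz.
have pz' : d.-primitive_root (z ^+ d.-1).
  by rewrite prim_root_exp_coprime // coprimePn.
have zz' i : z ^+ i * (z ^+ d.-1) ^+ i = 1.
  by rewrite -exprMn -exprS prednK // (prim_expr_order pz) expr1n.
pose c := \prod_(i < d) z ^+ i.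
have AE : \prod_(i < d) ((z ^+ i)%:P * 'X - 1) = c%:P * ('X^d - 1) :> {poly F}.
  rewrite -(factor_Xn_sub_1 pz') big_mkord rmorph_prod -big_split /=.
  by apply: eq_bigr => i _; rewrite mulrBr -polyCM zz'.
have cE : (-1) ^+ d = - c.
  have := congr1 (horner^~ 0) AE; rewrite horner_prod.
  under eq_bigr do rewrite !hornerE ?mulr0 ?sub0r.
  by rewrite prodr_const card_ord !hornerE expr0n gtn_eqF //= sub0r mulrN1.
have -> : (-1) ^+ d = - c%:P :> {poly F} by rewrite -[RHS]polyCN -cE rmorph_sign.
by rewrite AE mulNr -mulrN opprB.
Qed.

Lemma prod_geom_prim_root (F : fieldType) (b d : nat) (z : F) :
  coprime b d -> d.-primitive_root z ->
  \prod_(i < d) \sum_(j < b) ((z ^+ i)%:P * 'X) ^+ j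
    = \sum_(j < b) 'X^(d * j) :> {poly F}.
Proof.
move=> bd pz; have d_gt0 := prim_order_gt0 pz.
(* This is the product of the denominators y - 1, to be cancelled. *)
have nz : (-1) ^+ d * (1 - 'X^d) != 0 :> {poly F}.
  by rewrite mulf_neq0 ?signr_eq0 // -opprB oppr_eq0 -size_poly_eq0 size_XnsubC.
apply: (mulfI nz); rewrite -[in LHS](prod_prim_root pz) -big_split /=.
have pzb : d.-primitive_root (z ^+ b) by rewrite prim_root_exp_coprime.
under eq_bigr do rewrite -subrX1.
(* The numerators (z^i X)^b - 1 are the factors for the primitive root [z ^+ b], taken at X^b. *)
transitivity (((-1) ^+ d * (1 - 'X^d)) \Po 'X^b : {poly F}).
  rewrite -(prod_prim_root pzb) rmorph_prod /=; apply: eq_bigr => i _.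
  rewrite rmorphB rmorph1 rmorphM /= comp_polyC comp_polyX.
  by rewrite exprMn -rmorphXn -!exprM mulnC.
rewrite rmorphM rmorph_sign rmorphB rmorph1 /= comp_Xn_poly -mulrA; congr (_ * _).
under [in RHS]eq_bigr do rewrite exprM.
by rewrite -[RHS]opprK -mulNr opprB -subrX1 opprB -!exprM mulnC.
Qed.

(** * The generating polynomial at a root of unity *)

Lemma expr_sum_tuple (K : comNzRingType) (b c e : nat) :
  (\sum_(j < b) 'X^(c * j)) ^+ e
    = \sum_(u : e.-tuple 'I_b) 'X^(c * \sum_(j <- u) j) :> {poly K}.
Proof.
rewrite -[e in LHS]card_ord -prodr_const bigA_distr_bigA /=.
rewrite (reindex (@finfun_of_tuple 'I_b e)) /=; last first.
  by exists tuple_of_finfun => u _; rewrite ?finfun_of_tupleK ?tuple_of_finfunK.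
apply: eq_bigr => u _; rewrite big_tuple big_distrr /= expr_sum.
by apply: eq_bigr => i _; rewrite ffunE.
Qed.

(** Evaluating the coefficients at q = w is a ring morphism, which can then be carried through the
    product defining [qbinom]. *)
Lemma evalN_coef (K : comNzRingType) (P : {poly {poly nat}}) (k : nat) (w : K) :
  evalN P`_k w =
  (map_poly (horner_eval w \o map_poly (GRing.natmul (1 : K))) P)`_k.
Proof. by rewrite coef_map. Qed.

Lemma evalN_qbinom (K : comNzRingType) (b n k : nat) (w : K) :
  evalN (qbinom b n k) w =
  (\prod_(i < n) \sum_(j < b) ((w ^+ i)%:P * 'X) ^+ j)`_k.
Proof.
rewrite evalN_coef; congr (polyseq _)`_k; rewrite rmorph_prod /=; apply: eq_bigr => i _.
rewrite rmorph_sum /=; apply: eq_bigr => j _.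
rewrite rmorphXn rmorphM /= map_polyC map_polyX /=.
by rewrite !rmorphXn /= map_polyX /horner_eval !hornerE.
Qed.

(** Since w^d = 1, the factors have period [d]: [e] full periods, then at most one factor, with w^(d
    e) = 1. The exponent [1 * j] fits [expr_sum_tuple]. *)
Lemma prod_geom_periodic (F : fieldType) (b d e r : nat) (w : F) :
  coprime b d -> d.-primitive_root w -> (r <= 1)%N ->
  \prod_(i < d * e + r) \sum_(j < b) ((w ^+ i)%:P * 'X) ^+ j
    = (\sum_(j < b) 'X^(d * j)) ^+ e * (\sum_(j < b) 'X^(1 * j)) ^+ r
    :> {poly F}.
Proof.
move=> bd pw r1; have wde i : w ^+ (d * e + i) = w ^+ i.
  by rewrite exprD exprM (prim_expr_order pw) expr1n mul1r.
rewrite big_split_ord /=; congr (_ * _); last first.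
  case: r r1 => [|[|//]] _; first by rewrite big_ord0 expr0.
  rewrite big_ord1 expr1; apply: eq_bigr => j _.
  by rewrite wde expr0 mul1r mul1n.
rewrite mulnC; elim: e {wde} => [|e IHe]; first by rewrite big_ord0 expr0.
rewrite mulSn big_split_ord /= exprS prod_geom_prim_root //; congr (_ * _).
rewrite -IHe; apply: eq_bigr => i _; apply: eq_bigr => j _.
by rewrite exprD (prim_expr_order pw) mul1r.
Qed.

(** * Counting the fixed tuples *)

Lemma sum_tnthE (b n : nat) (x : n.-tuple 'I_b) :
  (\sum_(i < n) (tnth x i : nat) = \sum_(j <- x) j)%N.
Proof. by rewrite big_tuple. Qed.

(** A pair [(u, v)] corresponds to [d] copies of [u] followed by [v], so entries of [u] weigh [d] in
    the sum and entries of [v] weigh 1. *)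
Lemma card_rot_fixed (b d e r k : nat) :
  (0 < d)%N ->
  #|[set x : Xset b (d * e + r) k |
      rot e (take (d * e) (val x)) == take (d * e) (val x)]|
  = #|[set p : e.-tuple 'I_b * r.-tuple 'I_b |
      (k == d * (\sum_(j <- p.1) j) + 1 * (\sum_(j <- p.2) j))%N]|.
Proof.
move=> d_gt0.
have szP (p : e.-tuple 'I_b * r.-tuple 'I_b) :
    size (flatten (nseq d (tval p.1)) ++ p.2) == (d * e + r)%N.
  rewrite size_cat size_flatten /shape map_nseq sumn_nseq !size_tuple.
  by rewrite mulnC.
pose g p := Tuple (szP p).
have sumg p : (\sum_(j <- g p) j =
    d * (\sum_(j <- p.1) j) + 1 * (\sum_(j <- p.2) j))%N.
  rewrite /g /= big_cat /= mul1n; congr addn.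
  elim: (d) => [|d' IH]; first by rewrite big_nil.
  by rewrite /= big_cat /= IH mulSn.
rewrite -(card_imset _ val_inj).
have inj_g : injective g.
  move=> [u v] [u' v'] /(congr1 val) /= /eqP.
  have szf (t : e.-tuple 'I_b) : size (flatten (nseq d (tval t))) = (e * d)%N.
    by rewrite size_flatten /shape map_nseq sumn_nseq size_tuple.
  rewrite eqseq_cat ?szf // => /andP[/eqP uu' /eqP vv'].
  congr pair; apply: val_inj => //=.
  (* As [d] is positive, [u] can be read off the first copy. *)
  have := congr1 (take e) uu'; case: (d) d_gt0 => // d' _ /=.
  by rewrite !take_size_cat ?size_tuple.
rewrite -(card_imset _ inj_g); apply: eq_card => y.
apply/imsetP/imsetP => [[x]|[p]]; rewrite inE.
  set s := tval (val x) => /eqP fixs ->.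
  have szs : size s = (d * e + r)%N by rewrite size_tuple.
  have szt : size (take (d * e) s) = (d * e)%N.
    by rewrite size_takel // szs leq_addr.
  have szu : size (take e s) == e.
    by rewrite size_takel // szs (leq_trans (leq_pmull _ d_gt0)) ?leq_addr.
  have szv : size (drop (d * e) s) == r by rewrite size_drop szs addKn.
  pose p := (Tuple szu, Tuple szv).
  have gp : val x = g p.
    apply: val_inj; rewrite /= -[LHS](cat_take_drop (d * e)); congr cat.
    rewrite (rot_fixed_flatten szt fixs) take_takel //.
    by rewrite leq_pmull.
  exists p => //; rewrite inE -sumg -gp.
  by have := valP x; rewrite /= sum_tnthE eq_sym.
move=> kp ->.
have gX : (\sum_(i < d * e + r) (tnth (g p) i : nat) == k)%N.
  by rewrite sum_tnthE sumg eq_sym.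
exists (Sub (g p) gX : Xset b (d * e + r) k) => //.
rewrite inE /= take_size_cat; last first.
  by rewrite size_flatten /shape map_nseq sumn_nseq size_tuple mulnC.
by rewrite -[X in rot X](size_tuple p.1) rot_flatten_nseq.
Qed.

(** At most one entry lies outside the rotated block. Expanding the powers over tuples makes the
    coefficient of X^k a count of pairs [(u, v)] of weighted sum [k]. *)
Lemma evalN_qbinom_card (F : fieldType) (b n m d k : nat) (w : F) :
  coprime b d -> d.-primitive_root w -> (d %| m)%N -> (m <= n <= m.+1)%N ->
  evalN (qbinom b n k) w =
  #|[set x : Xset b n k |
      rot (m %/ d) (take m (val x)) == take m (val x)]|%:R.
Proof.
move=> bd pw /dvdnP[e ->] /andP[mn nm]; have d_gt0 := prim_order_gt0 pw.
rewrite mulnK // mulnC in mn nm *.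
rewrite -(subnKC mn); have : (n - d * e <= 1)%N by rewrite leq_subLR addn1.
move: (n - d * e)%N => r {mn nm} r1.
rewrite evalN_qbinom prod_geom_periodic // card_rot_fixed //.
rewrite !expr_sum_tuple big_distrlr pair_big /= coef_sum.
under eq_bigr do rewrite -exprD coefXn.
by rewrite -natr_sum -big_mkcond /= sum1_card cardsE.
Qed.

(** * Cyclic sieving for the rotation of the first [m] entries *)

Section Sieving.

Variables (b n k m : nat) (s : {perm Xset b n k}).
Hypothesis sE : forall x, val (val (s x)) = rot_take m (val (val x)).
Hypothesis mn : (m <= n)%N.

Lemma val_expg_rot_take (j : nat) (x : Xset b n k) : (j <= m)%N ->
  val (val ((s ^+ j)%g x)) =
  rot j (take m (val (val x))) ++ drop m (val (val x)).
Proof.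
move=> jm; rewrite -iter_rot_take ?jm ?size_tuple // permX.
by elim: j {jm} => [//|j IHj]; rewrite !iterS sE IHj.
Qed.

Lemma expg_rot_take_fixed (j : nat) (x : Xset b n k) : (j <= m)%N ->
  ((s ^+ j)%g x == x) = (rot j (take m (val x)) == take m (val x)).
Proof.
move=> jm; rewrite -2!val_eqE /= val_expg_rot_take //.
rewrite -[X in _ == X](cat_take_drop m (val (val x))).
by rewrite eqseq_cat ?eqxx ?andbT // size_rot.
Qed.

Lemma expg_rot_take_order : (s ^+ m = 1)%g.
Proof.
apply/permP => x; rewrite perm1; apply/eqP; rewrite expg_rot_take_fixed //.
by rewrite rot_oversize // size_take_min geq_minl.
Qed.

Lemma evalN_qbinom_fixed (F : fieldType) (d : nat) (w : F) :
  (n <= m.+1)%N -> (d %| m)%N -> coprime b d -> d.-primitive_root w ->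
  evalN (qbinom b n k) w = #|[set x | (s ^+ (m %/ d))%g x == x]|%:R.
Proof.
move=> nm dm bd pw; rewrite (evalN_qbinom_card _ bd pw dm) ?mn //.
congr (_%:R); apply: eq_card => x.
by rewrite !inE expg_rot_take_fixed // leq_div.
Qed.

Lemma cyclic_sieving_rot_take (R : realType) :
  (n <= m.+1)%N -> (0 < m)%N -> coprime b m ->
  cyclic_sieving R (qbinom b n k) m s.
Proof.
move=> nm m_gt0 bm; split=> // [|d w dm pw]; first exact: expg_rot_take_order.
by apply: evalN_qbinom_fixed => //; apply: coprime_dvdr bm.
Qed.

End Sieving.

Lemma val_rho (b n k : nat) (x : Xset b n k) :
  val (val (rho b n k x)) = rot_take n (val (val x)).
Proof.
by rewrite permE /= /rot_take take_oversize ?drop_oversize ?cats0 ?size_tuple.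
Qed.

Lemma val_tau (b n k : nat) (x : Xset b n k) :
  val (val (tau b n k x)) = rot_take (n - 1) (val (val x)).
Proof. by rewrite permE /= /rot_init size_tuple subn1. Qed.

Theorem theorem2p2 (R : realType) (b n k : nat) (hb : (2 <= b)%N) (hn : (1 <= n)%N) :
  ((coprime b n -> cyclic_sieving R (qbinom b n k) n (rho b n k)) /\
   (forall (d : nat) (w : R[i]),
      (d %| n)%N -> coprime b d -> d.-primitive_root w ->
      evalN (qbinom b n k) w =
        #|[set x : Xset b n k | (rho b n k ^+ (n %/ d))%g x == x]|%:R)) /\
  ((coprime b (n - 1) -> cyclic_sieving R (qbinom b n k) (n - 1) (tau b n k)) /\
   (forall (d : nat) (w : R[i]),
      (d %| n - 1)%N -> coprime b d -> d.-primitive_root w ->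
      evalN (qbinom b n k) w =
        #|[set x : Xset b n k | (tau b n k ^+ ((n - 1) %/ d))%g x == x]|%:R)).
Proof.
have n1n : (n <= (n - 1).+1)%N by rewrite subn1 prednK.
split; split.
- by apply: cyclic_sieving_rot_take => // x; apply: val_rho.
- by move=> d w; apply: evalN_qbinom_fixed => //; apply: val_rho.
- move=> bn; apply: cyclic_sieving_rot_take => //.
  + exact: val_tau.
  + exact: leq_subr.
  (* If [n - 1] were 0, coprimality would read gcd(b, 0) = 1, so b = 1, against [hb]. *)
  rewrite lt0n; apply: contraTneq bn => ->.
  by rewrite /coprime gcdn0 gtn_eqF.
- move=> d w; apply: evalN_qbinom_fixed => //; first exact: val_tau.
  exact: leq_subr.
Qed.
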